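(* Let $D=(V,E)$ be a finite, simple, directed graph with minimum out-degree $\delta\ge 1$ and maximum in-degree at most $\Delta\ge 1$. If $$\Delta\le\frac{2^{\delta}}{e\,\delta},$$ then the digraph $D$ contains an even-length directed cycle. In particular, this holds (i.e. $D$ contains an even-length directed cycle) for every finite, simple, $d$-regular digraph $D$ with $d\ge 8$.
   Context: A $d$-regular digraph is a directed graph in which the in-degree and the out-degree of every vertex are equal to $d$. Simple means no loops and no parallel arcs (two arcs with the same tail and same head). $e$ in the inequality is the base of the natural logarithm. *)

(* Defs.v *)
From mathcomp Require Import all_boot.

Set Implicit Arguments.
Unset Strict Implicit.
Unset Printing Implicit Defensive.

(* A digraph on V is its arc relation E : rel V, with E u v meaning that u -> v
   is an arc, so parallel arcs are excluded by construction. Opposite arcs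
   u -> v and v -> u are allowed together; they form a cycle of length 2. *)
Section Digraph.

Variables (V : finType) (E : rel V).

Definition simple_digraph : Prop := irreflexive E.

Definition outdeg (v : V) : nat := #|[set w | E v w]|.

Definition indeg (v : V) : nat := #|[set u | E u v]|.

(* The minimum is attained, so this forces V to be nonempty. *)
Definition min_outdeg_is (delta : nat) : Prop :=
  (forall v, delta <= outdeg v) /\ (exists v, outdeg v = delta).

Definition max_indeg : nat := \max_(v : V) indeg v.

Definition regular_digraph (d : nat) : Prop :=
  forall v, indeg v = d /\ outdeg v = d.

(* Cycles visit pairwise distinct vertices; c lists them in order, and
   the length of the cycle is size c. *)
Definition has_even_dicycle : Prop :=
  exists c : seq V, [/\ c != [::], uniq c, cycle E c & ~~ odd (size c)].

End Digraph.

(* Main.v *)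
Require Import Defs.
From mathcomp Require Import all_boot all_order all_algebra.
From mathcomp Require Import all_reals all_analysis.
From mathcomp Require Import ring lra zify.

(* Colour the vertices with two colours. If every vertex has an out-neighbour
   of the other colour, following such arcs leads to an even cycle. Such a
   colouring comes from a counting form of the local lemma. Keep exactly
   [delta] out-neighbours [F v] of each [v], call [v] bad when [v |: F v] is
   monochromatic, and let [N S] be the number of colourings with no bad vertex
   in [S]. For each [w], the at most [Delta + 1] stars containing [w] are treated
   together: by induction on [#|S|], removing all of them from [S] multiplies
   [N S] by at most [y^-1], since a bad [u] in [S] leaves the colours on [F u]
   unused and so has at most [2 ^- delta * y ^- k * N (S minus the stars at w)]
   colourings, where [k] counts the elements of [F u] other than [w]. Here
   [k = delta - 1] unless [u = w], so the induction closes as soon as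
   [2 ^- delta * (Delta * y ^- (delta - 1) + y ^- delta) <= 1 - y]. Grouping by
   [w] is what avoids the [+ 1] of the symmetric local lemma, and it does not
   require the dependency relation to be symmetric. *)

Set Implicit Arguments.
Unset Strict Implicit.
Unset Printing Implicit Defensive.

Import Order.TTheory GRing.Theory Num.Theory.

(** * Alternating colourings and even cycles *)

Lemma periodic_point (T : finType) (g : T -> T) (x : T) :
  exists y k, iter k.+1 g y = y.
Proof.
have /injectivePn[i [j neq_ij eq_ij]] :
    ~~ injectiveb (fun i : 'I_#|T|.+1 => iter i g x).
  apply/negP => /injectiveP/leq_card.
  by rewrite card_ord ltnn.
wlog lt_ij : i j neq_ij eq_ij / i < j.
  move=> hw; case: (ltngtP i j) => [||/val_inj/eqP]; first exact: hw.
    by apply: hw; rewrite // eq_sym.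
  by rewrite (negPf neq_ij).
exists (iter i g x), (j - i).-1.
by rewrite prednK ?subn_gt0// -iterD subnK// ltnW.
Qed.

Lemma alternating_even_dicycle (V : finType) (E : rel V) (f : V -> bool) :
  0 < #|V| -> (forall v, exists2 w, E v w & f w != f v) -> has_even_dicycle E.
Proof.
move=> /card_gt0P[v0 _] alt.
have alt' v : exists w, E v w && (f w != f v).
  by have [w Ew fw] := alt v; exists w; rewrite Ew.
pose g v := xchoose (alt' v).
have gP v : E v (g v) && (f (g v) != f v) := xchooseP (alt' v).
have [x [k xk]] := periodic_point g v0.
have cyc : fcycle g (orbit g x) by apply: (all_iffLR orbitPcycle 3 0); exists k.
have period : iter (order g x) g x = x.
  exact: (all_iffLR orbitPcycle 0 4).
(* Colours alternate along the orbit, so the return to [x] takes an even number of steps. *)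
have flip n : f (iter n g x) = odd n (+) f x.
  elim: n => //= n IHn; have /andP[_] := gP (iter n g x).
  by rewrite IHn; case: (f (g _)); case: (odd n); case: (f x).
exists (orbit g x); split.
- by rewrite -size_eq0 size_orbit -lt0n order_gt0.
- exact: orbit_uniq.
- apply: sub_cycle cyc => u v /eqP <-.
  by case/andP: (gP u).
- rewrite size_orbit; have := flip (order g x).
  by rewrite period; case: (odd _) => //; case: (f x).
Qed.

(** * Colourings without bad stars *)

Section BadStars.

Variables (V : finType) (F : V -> {set V}).

Definition bad (v : V) (f : {ffun V -> bool}) : bool :=
  [forall w in F v, f w == f v].

Definition good_colorings (S : {set V}) : {set {ffun V -> bool}} :=
  [set f | [forall u in S, ~~ bad u f]].

Definition star_class (w : V) : {set V} := [set u | w \in u |: F u].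

Lemma good_coloringsS (S T : {set V}) :
  S \subset T -> good_colorings T \subset good_colorings S.
Proof.
move=> /subsetP sST; apply/subsetP => f; rewrite !inE => /forall_inP fT.
by apply/forall_inP => u /sST/fT.
Qed.

(* Recolouring [F v] arbitrarily does not affect the stars centred in [T],
   and the original colouring, constant on [v |: F v], is recovered from the
   new one. *)
Lemma card_bad_good (v : V) (T : {set V}) :
  v \notin F v -> {in T, forall u, [disjoint F v & u |: F u]} ->
  #|[set f in good_colorings T | bad v f]| * 2 ^ #|F v|
    <= #|good_colorings T|.
Proof.
move=> vNF disT; rewrite -card_powerset -cardsX.
pose h (p : {ffun V -> bool} * {set V}) : {ffun V -> bool} :=
  [ffun w => p.1 w (+) (w \in p.2)].
rewrite -(card_in_imset (f := h)).
  apply: subset_leq_card; apply/subsetP => _ /imsetP[[f B] fB ->].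
  move: fB; rewrite !inE /= => /andP[/andP[/forall_inP fT _] /subsetP BF].
  have hE u w : u \in T -> w \in u |: F u -> h (f, B) w = f w.
    move=> uT wu; rewrite ffunE /=; case: (boolP (w \in B)) => [/BF wF|_].
      by move/pred0P/(_ w): (disT u uT); rewrite /= wF wu.
    exact: addbF.
  apply/forall_inP => u uT; apply: contra (fT u uT) => /forall_inP hu.
  apply/forall_inP => w wu.
  by have := hu w wu; rewrite !(hE u) // !inE ?eqxx ?wu ?orbT.
move=> [f B] [f' B']; rewrite !inE /=.
move=> /andP[/andP[_ /forall_inP fb] /subsetP BF].
move=> /andP[/andP[_ /forall_inP fb'] /subsetP BF'] /ffunP hh.
have out w : w \notin F v -> f w = f' w.
  move=> wNF; have := hh w; rewrite !ffunE /=.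
  by rewrite !(contraNF (@BF _) wNF, contraNF (@BF' _) wNF) !addbF.
have ff' : f = f'.
  apply/ffunP => w; have [wF|/out//] := boolP (w \in F v).
  by rewrite (eqP (fb w wF)) (eqP (fb' w wF)) out.
congr pair => //; apply/setP => w; have := hh w.
by rewrite !ffunE ff' /=; apply: addbI.
Qed.

End BadStars.

(** * Counting form of the local lemma *)

Section LocalLemma.

Local Open Scope ring_scope.

Variables (R : realFieldType) (V : finType) (F : V -> {set V}).
Variables (delta Delta : nat) (y : R).

Hypothesis loopless : forall v, v \notin F v.
Hypothesis card_F : forall v, #|F v| = delta.
Hypothesis indeg_F : forall w, (#|[set u | w \in F u]| <= Delta)%N.
Hypothesis y_gt0 : 0 < y.
Hypothesis y_le1 : y <= 1.
Hypothesis weight : Delta%:R * y + 1 <= 2 ^+ delta * (1 - y) * y ^+ delta.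

Local Notation N S := (#|good_colorings F S|%:R : R).
Local Notation K := (star_class F).

(** The classes are removed one at a time; the sets only shrink, so each removal costs one factor
    [y]. *)
Lemma good_classes (m : nat) (W S : {set V}) :
  (forall (S' : {set V}) w, (#|S'| < m)%N -> y * N (S' :\: K w) <= N S') ->
  (#|S| < m)%N ->
  y ^+ #|W| * N (S :\: \bigcup_(w in W) K w) <= N S.
Proof.
move=> IH; move: {2}#|W| (erefl #|W|) => n.
elim: n W S => [|n IHn] W S cW Sm.
  by move/eqP: cW; rewrite cards_eq0 => /eqP ->; rewrite cards0 big_set0 setD0 mul1r.
have /card_gt0P[w wW] : (0 < #|W|)%N by rewrite cW.
rewrite (big_setD1 w wW) /= -setDDl cW exprS -mulrA.
have cW' : #|W :\ w| = n by move: cW; rewrite (cardsD1 w) wW => -[].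
apply: le_trans (IH S w Sm); rewrite ler_pM2l // -cW'.
by apply: IHn => //; apply: leq_ltn_trans Sm; apply: subset_leq_card; apply: subsetDl.
Qed.

(** Stars through [w] are already gone, so any star still meeting [F u] contains a vertex of [W].
    Removing those classes costs [y ^+ #|W|] and leaves [F u] free to be recoloured. *)
Lemma card_bad_class (S : {set V}) (u w : V) (W : {set V}) :
  (forall (W T : {set V}), T \subset S :\: K w ->
     y ^+ #|W| * N (T :\: \bigcup_(w in W) K w) <= N T) ->
  F u \subset w |: W ->
  2 ^+ delta * y ^+ #|W|
    * #|[set f in good_colorings F (S :\: K w) | bad F u f]|%:R
  <= N (S :\: K w).
Proof.
move=> IH FW; set T := S :\: K w; set T' := T :\: \bigcup_(w in W) K w.
apply: le_trans (IH W T (subxx _)).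
rewrite (mulrC (2 ^+ _)) -mulrA ler_pM2l ?exprn_gt0 //.
have /(card_bad_good (loopless u)) :
    {in T', forall x, [disjoint F u & x |: F x]}.
  move=> x; rewrite !inE => /andP[/bigcupP xW /andP[xw _]].
  apply/pred0P => z; apply/negbTE/negP => /= /andP[/(subsetP FW)].
  rewrite in_setU1 => /orP[/eqP ->|zW] zx; first by move: xw; rewrite -in_setU1 zx.
  by apply: xW; exists z; rewrite // inE.
rewrite card_F -(ler_nat R) natrM natrX; apply: le_trans.
rewrite mulrC ler_pM2r ?exprn_gt0 ?ltr0n // ler_nat.
apply/subset_leq_card/subsetP => f /setIdP[fT fb]; apply/setIdP; split=> //.
by apply: subsetP fT; rewrite good_coloringsS ?subsetDl.
Qed.

Lemma good_class (S : {set V}) (w : V) : y * N (S :\: K w) <= N S.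
Proof.
move: {2}#|S|.+1 (ltnSn #|S|) => m; elim: m S w => // m IHm S w Sm.
have [/setDidPl ->|] := boolP [disjoint S & K w].
  by rewrite ler_piMl // ler0n.
rewrite -setI_eq0 -card_gt0 => SK; set T := S :\: K w.
have Tm : (#|T| < m)%N.
  by apply: leq_trans (_ : #|S| <= m)%N => //; rewrite -(cardsID (K w) S) -add1n leq_add2r.
have IH (W T' : {set V}) : T' \subset T ->
    y ^+ #|W| * N (T' :\: \bigcup_(w in W) K w) <= N T'.
  move=> T'T; apply: (good_classes (m := m)) => //.
  exact: leq_ltn_trans (subset_leq_card T'T) Tm.
pose B u := [set f in good_colorings F T | bad F u f].
have pos : 0 < 2 ^+ delta * y ^+ delta by rewrite mulr_gt0 ?exprn_gt0 ?ltr0n.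
have Bw : 2 ^+ delta * y ^+ delta * #|B w|%:R <= N T.
  by rewrite -{2}(card_F w); apply: card_bad_class => //; apply: subsetUr.
(* Here [w] lies in [F u], so only [delta - 1] classes are removed, which gains a factor [y]. *)
have Bu u : w \in F u -> 2 ^+ delta * y ^+ delta * #|B u|%:R <= y * N T.
  move=> wu; rewrite -[X in y ^+ X](card_F u) (cardsD1 w) wu exprS.
  rewrite (mulrCA _ y) -(mulrA y) ler_pM2l //; apply: card_bad_class => //.
  by rewrite setD1K.
have cover : good_colorings F T \subset
    good_colorings F S :|: (B w :|: \bigcup_(u in [set u | w \in F u]) B u).
  apply/subsetP => f fT; apply/setUP.
  have [|fS] := boolP (f \in good_colorings F S); [by left|right].
  move: fS; rewrite inE negb_forall_in => /exists_inP[u uS]; rewrite negbK => fu.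
  have /setU1P[wu|wu] : w \in u |: F u.
    apply: contraLR fu => uK; move: fT; rewrite inE => /forall_inP; apply.
    by rewrite in_setD uS inE uK.
  - by rewrite wu; apply/setUP; left; apply/setIdP.
  - apply/setUP; right; apply/bigcupP; exists u; first by rewrite inE.
    exact/setIdP.
have {cover} : N T <= N S + (#|B w|%:R + \sum_(u in [set u | w \in F u]) #|B u|%:R).
  rewrite -natr_sum -!natrD ler_nat; apply: leq_trans (subset_leq_card cover) _.
  apply: leq_trans (leq_card_setU _ _) _; rewrite leq_add2l.
  apply: leq_trans (leq_card_setU _ _) _; rewrite leq_add2l.
  by elim/big_rec2: _ => [|u c A _ cA]; rewrite ?cards0 // (leq_trans (leq_card_setU _ _)) ?leq_add2l.
have sumB : 2 ^+ delta * y ^+ delta *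
    (\sum_(u in [set u | w \in F u]) #|B u|%:R) <= Delta%:R * (y * N T).
  rewrite mulr_sumr; apply: le_trans (_ : \sum_(u in [set u | w \in F u]) y * N T <= _).
    by apply: ler_sum => u; rewrite inE; apply: Bu.
  rewrite sumr_const -(mulr_natl (y * N T)); apply: ler_wpM2r.
    by rewrite mulr_ge0 ?ler0n ?ltW.
  by rewrite ler_nat.
have : (Delta%:R * y + 1) * N T <= 2 ^+ delta * (1 - y) * y ^+ delta * N T.
  by apply: ler_wpM2r weight; apply: ler0n.
move: Bw sumB pos; move: (\sum_(u in _) _) (#|B w|%:R) (N T) (N S).
move: (2 ^+ delta) (y ^+ delta) => a b s t n n' h1 h2 h3 h4 h5.
rewrite -(ler_pM2l h3); nra.
Qed.

Lemma exists_good_coloring :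
  exists f : V -> bool, forall v, exists2 w, w \in F v & f w != f v.
Proof.
(* Removing all classes leaves no star, so every colouring is then counted. *)
have : 0 < N [set: V].
  apply: lt_le_trans (good_classes [set: V] (fun S w _ => good_class S w) (ltnSn _)).
  rewrite mulr_gt0 ?exprn_gt0 // ltr0n card_gt0; apply/set0Pn.
  exists [ffun=> true]; rewrite inE; apply/forall_inP => u; rewrite !inE andbT => /bigcupP[].
  by exists u; rewrite ?inE ?eqxx.
rewrite ltr0n card_gt0 => /set0Pn[f]; rewrite inE => /forall_inP fP.
exists f => v; have := fP v (in_setT v).
by rewrite negb_forall_in => /exists_inP.
Qed.

End LocalLemma.

(** * Numerical bounds *)

Section ExpBounds.

Local Open Scope ring_scope.

Variable R : realType.

Lemma expR_ge_series (x : R) (n : nat) :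
  0 <= x -> \sum_(0 <= i < n) exp_coeff x i <= expR x.
Proof.
move=> x0; rewrite /expR.
apply: (nondecreasing_cvgn_le (u_ := series (exp_coeff x))).
  by apply: nondecreasing_series => i _ _; apply: exp_coeff_ge0.
exact: is_cvg_series_exp_coeff.
Qed.

(** [8 / 3] is the threshold for [256 / (8 * expR 1) < 12]; it also refutes
    [expR 1 * 7 ^ 2 <= 2 ^ 7]. *)
Lemma expR1_gt : 8%:R / 3%:R < expR 1 :> R.
Proof.
apply: lt_le_trans (expR_ge_series 5 ler01).
rewrite !big_nat_recr // big_nil /exp_coeff /= !expr1n !factS fact0; lra.
Qed.

(** The 16th power of [1 - 1 / 16 <= expR (- 1 / 16)] suffices. The value [2.82] is small enough for
    the case [delta = 9] of [weight_exists], where [282 * 181 <= 51200]. *)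
Lemma expR1_lt : expR 1 < 282%:R / 100%:R :> R.
Proof.
have h : 1 - 16%:R^-1 <= expR (- 16%:R^-1) :> R by apply: expR_ge1Dx.
have e0 := expR_gt0 (1 : R).
have : (1 - 16%:R^-1) ^+ 16 <= (expR 1)^-1 :> R.
  rewrite -expRN (_ : - 1 = 16%:R * - 16%:R^-1 :> R); last by lra.
  rewrite expRM_natl; apply: lerXn2r => //; rewrite nnegrE ?expR_ge0 //; lra.
rewrite -(ler_pM2r e0) mulVf ?gt_eqF // => h2.
rewrite ltNge; apply/negP => h3.
have : (1 - 16%:R^-1) ^+ 16 * (282%:R / 100%:R) <= 1 :> R.
  by apply: le_trans h2; rewrite ler_wpM2l // exprn_ge0 //; lra.
lra.
Qed.

(* With [y = expR (- delta^-1)] the quotient by [y ^+ delta] of the first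
   summand is [Delta * expR (1 - delta^-1) <= 2 ^+ delta / delta * y], so the
   requirement reduces to [expR 1 <= 2 ^+ delta * (1 - (1 + delta^-1) * y)].
   This fails for [delta = 8], where instead the integrality of [Delta] is
   used. *)
Lemma weight_exists (delta Delta : nat) :
  (8 <= delta)%N ->
  Delta%:R <= 2 ^+ delta / (expR 1 * delta%:R) :> R ->
  exists y : R, [/\ 0 < y, y <= 1 &
    Delta%:R * y + 1 <= 2 ^+ delta * (1 - y) * y ^+ delta].
Proof.
have e0 := expR_gt0 (1 : R); have e_lt := expR1_lt; have e_gt := expR1_gt.
rewrite leq_eqVlt => /orP[/eqP <-|delta9] hD.
  have {hD} : (Delta < 12)%N.
    rewrite -(ltr_nat R); apply: le_lt_trans hD _.
    rewrite ltr_pdivrMr; last by lra.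
    lra.
  rewrite ltnS -(ler_nat R) => D11.
  (* [11 * 7 / 8 + 1 <= 32 * (7 / 8) ^ 8] holds, but fails with [12] for [11]. *)
  exists (7%:R / 8%:R); split; lra.
have d0 : 0 < delta%:R :> R by rewrite ltr0n (leq_trans _ delta9).
set d : R := delta%:R in d0 hD *.
(* With [X = d * expR d^-1] the goal will become [expR 1 * X <= 2 ^+ delta * (X - d - 1)]. As
   [X - d - 1 >= 1 / (2 * d)], multiplying [X - d - 1] by this quadratic gives at least [X]. *)
have pow : expR 1 * (2%:R * d ^+ 2 + 2%:R * d + 1) <= 2 ^+ delta :> R.
  have : (282 * (2 * delta ^ 2 + 2 * delta + 1) <= 100 * 2 ^ delta)%N.
    elim: delta delta9 {hD d0 d} => // k IHk; rewrite leq_eqVlt => /orP[/eqP <- //|k9].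
    have := IHk k9; rewrite [(2 ^ k.+1)%N]expnS.
    move: (2 ^ k)%N => a; rewrite -!mulnn => h; nia.
  rewrite -(ler_nat R) !(natrM, natrD, natrX) -/d => h.
  have : 0 < 2%:R * d ^+ 2 + 2%:R * d + 1 by nra.
  move: (2%:R * _ + _ + _) h => b h b0.
  have : expR 1 * b <= 282%:R / 100%:R * b by rewrite ler_pM2r // ltW.
  lra.
have s0 : 0 < d^-1 by rewrite invr_gt0.
exists (expR (- d^-1)); split; first exact: expR_gt0.
  by rewrite expR_le1 oppr_le0 ltW.
rewrite -expRM_natl mulrN divff ?gt_eqF // !expRN.
set E := expR d^-1.
have E0 : 0 < E by apply: expR_gt0.
have E_ge : 1 + d^-1 + d^-1 ^+ 2 / 2%:R <= E.
  apply: le_trans (expR_ge_series 3 (ltW s0)).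
  by rewrite !big_nat_recr // big_nil /exp_coeff /= !factS fact0; lra.
have {}hD : Delta%:R * expR 1 * d <= 2 ^+ delta.
  by rewrite -mulrA -ler_pdivlMr // mulr_gt0.
rewrite ler_pdivlMr // -(ler_pM2r E0).
rewrite [X in X <= _](_ : _ = Delta%:R * expR 1 + expR 1 * E); last by field; rewrite gt_eqF.
rewrite [X in _ <= X](_ : _ = 2 ^+ delta * (E - 1)); last by field; rewrite gt_eqF.
rewrite -(ler_pM2r d0) [in X in X <= _]mulrDl; apply: le_trans (lerD hD (lexx _)) _.
have Ed : d ^+ 2 * E >= d ^+ 2 + d + 2%:R^-1.
  apply: le_trans (ler_wpM2l _ E_ge); last by rewrite exprn_ge0 // ltW.
  by rewrite le_eqVlt; apply/orP; left; apply/eqP; field; rewrite gt_eqF.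
set X := d * E; have {}Ed : 2%:R^-1 <= d * (X - d - 1) by rewrite /X; lra.
have t0 : 0 <= X - d - 1 by rewrite -(pmulr_rge0 _ d0); lra.
have : (2%:R * d ^+ 2 + 2%:R * d + 1) * (X - d - 1) >= X by nra.
rewrite -(ler_pM2l e0) [X in _ <= X]mulrA => h.
have {}h := le_trans h (ler_wpM2r t0 pow).
move: h; rewrite /X; lra.
Qed.

End ExpBounds.

(** * Double counting of arcs, and the conclusion *)

Lemma leq_mindeg_maxdeg (V : finType) (E : rel V) (delta Delta : nat) :
  0 < #|V| -> (forall v, delta <= outdeg E v) -> (forall v, indeg E v <= Delta) ->
  delta <= Delta.
Proof.
move=> V0 out_ge in_le; rewrite -(leq_pmul2l V0) -!sum_nat_const.
apply: leq_trans (leq_sum _ (fun v _ => in_le v)).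
apply: leq_trans (leq_sum _ (fun v _ => out_ge v)) _.
rewrite /outdeg /indeg.
under eq_bigr do rewrite -sum1_card big_mkcond.
under [X in _ <= X]eq_bigr do rewrite -sum1_card big_mkcond.
rewrite exchange_big /=; apply: leq_sum => w _; apply: leq_sum => v _.
by rewrite !inE.
Qed.

Lemma even_dicycle_degrees (R : realType) (V : finType) (E : rel V)
    (delta Delta : nat) :
  0 < #|V| -> simple_digraph E -> 8 <= delta ->
  (forall v, delta <= outdeg E v) -> (forall v, indeg E v <= Delta) ->
  (Delta%:R <= 2 ^+ delta / (expR 1 * delta%:R) :> R)%R ->
  has_even_dicycle E.
Proof.
move=> V0 simpleE delta8 out_ge in_le hD.
have /fin_all_exists[F FP] v :
    exists A : {set V}, A \subset [set w | E v w] /\ #|A| = delta.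
  have /card_geqP[s [uniq_s <- sN]] := out_ge v.
  exists [set x in s]; split; last by rewrite cardsE; apply/card_uniqP.
  by apply/subsetP => w; rewrite inE => /sN.
have FE v w : w \in F v -> E v w.
  by have [/subsetP sub _] := FP v; move/sub; rewrite inE.
have [y [y0 y1 wt]] := weight_exists delta8 hD.
have [|||f fP] := @exists_good_coloring R V F delta Delta y _ _ _ y0 y1 wt.
- by move=> v; apply/negP => /FE; rewrite simpleE.
- by move=> v; have [] := FP v.
- move=> w; apply: leq_trans (in_le w); apply/subset_leq_card/subsetP => u.
  by rewrite !inE => /FE.
apply: (@alternating_even_dicycle V E f V0) => v.
by have [w /FE Ew fw] := fP v; exists w.
Qed.

Theorem corollary6 (R : realType) :
  (forall (V : finType) (E : rel V) (delta Delta : nat),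
      simple_digraph E ->
      min_outdeg_is E delta -> 1 <= delta ->
      max_indeg E <= Delta -> 1 <= Delta ->
      (Delta%:R <= 2 ^+ delta / (expR 1 * delta%:R) :> R)%R ->
      has_even_dicycle E)
  /\
  (forall (V : finType) (E : rel V) (d : nat),
      0 < #|V| ->
      simple_digraph E ->
      regular_digraph E d -> 8 <= d ->
      has_even_dicycle E).
Proof.
have e0 := expR_gt0 (1 : R); split.
  move=> V E delta Delta simpleE [out_ge [v0 _]] delta1 /bigmax_leqP in_le _ hD.
  have V0 : 0 < #|V| by apply/card_gt0P; exists v0.
  have {}in_le v : indeg E v <= Delta by apply: in_le.
  apply: (even_dicycle_degrees V0 simpleE _ out_ge in_le hD).
  (* For [delta <= 7] the hypothesis contradicts [delta <= Delta]. *)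
  rewrite leqNgt; apply/negP => delta7.
  have dD := leq_mindeg_maxdeg V0 out_ge in_le.
  have d0 : (0 < delta%:R :> R)%R by rewrite ltr0n.
  have : (delta%:R <= 2 ^+ delta / (expR 1 * delta%:R) :> R)%R.
    by apply: le_trans hD; rewrite ler_nat.
  rewrite ler_pdivlMr ?mulr_gt0 // => {dD hD} hd.
  have := expR1_gt R; move: e0 hd; move: (expR 1) => e.
  move: delta1 delta7 {out_ge d0}.
  by case: delta => [|[|[|[|[|[|[|[|delta]]]]]]]] // _ _; lra.
move=> V E d V0 simpleE reg d8.
apply: (@even_dicycle_degrees R V E d d) => // [v|v|].
- by rewrite (reg v).2.
- by rewrite (reg v).1.
have d0 : (0 < d%:R :> R)%R by rewrite ltr0n (leq_trans _ d8).
rewrite ler_pdivlMr ?mulr_gt0 // mulrCA.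
(* [4] exceeds [expR 1], and the bound is an equality at [d = 8]. *)
have : 4 * (d * d) <= 2 ^ d.
  elim: d d8 {reg d0} => // k IHk; rewrite leq_eqVlt => /orP[/eqP <- //|k8].
  have := IHk k8; rewrite [2 ^ k.+1]expnS.
  by move: (2 ^ k) => a h; nia.
rewrite -(ler_nat R) !natrM natrX; apply: le_trans.
by rewrite ler_pM2r ?mulr_gt0 //; have := expR1_lt R; lra.
Qed.
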